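(* (i) For every $n\in\mathbb N=\{1,2,\ldots\}$, $M(n+1)$ implies $M(n)$; that is, every variety satisfying $M(n+1)$ satisfies $M(n)$. (ii) For every $n\in\mathbb N$, $M(n)$ does not imply $M(n+1)$; that is, there exists a variety that satisfies $M(n)$ but does not satisfy $M(n+1)$. (iii) Let $\Sigma$ be a finite set of first-order formulas (sentences) in the language of clone algebras of varieties. Then $\Sigma$, that is, the conjunction of all members of $\Sigma$, is not equivalent to TImC; in other words, it is not the case that for all varieties $\mathcal V$, the clone algebra $\mathfrak A(\mathcal V)$ satisfies all members of $\Sigma$ if and only if $\mathcal V$ satisfies TImC.
   Context: A tolerance of an algebra $\mathbf A=(A;F)$ is a reflexive, symmetric relation $\tau\subseteq A^2$ compatible with all operations in $F$; congruences are exactly the transitive tolerances. If $\phi\colon\mathbf B\to\mathbf A$ is a homomorphism and $\vartheta\subseteq B^2$, write $\phi(\vartheta)=\{(\phi(a),\phi(b)):(a,b)\in\vartheta\}$. A variety $\mathcal V$ satisfies TImC (its tolerances are homomorphic images of its congruences) if for every $\mathbf A\in\mathcal V$ and every tolerance $\tau$ of $\mathbf A$ there exist an algebra $\mathbf B\in\mathcal V$, a congruence $\vartheta$ of $\mathbf B$, and a homomorphism $\phi\colon\mathbf B\to\mathbf A$ such that $\tau=\phi(\vartheta)$. For $n\in\mathbb N=\{1,2,\ldots\}$, a variety $\mathcal V$ satisfies the condition $M(n)$ if for any pair $(f,g)$ of $2n$-ary terms such that the identity $$f(x_0,x_0,x_1,x_1,\ldots,x_{n-1},x_{n-1})\approx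 g(x_0,x_0,x_1,x_1,\ldots,x_{n-1},x_{n-1})$$ holds in $\mathcal V$, there exists a $4n$-ary term $h$ such that the identities $$f(x_0,y_0,\ldots,x_{n-1},y_{n-1})\approx h(x_0,y_0,\ldots,x_{n-1},y_{n-1},x_0,y_0,\ldots,x_{n-1},y_{n-1}),$$ $$g(x_0,y_0,\ldots,x_{n-1},y_{n-1})\approx h(y_0,x_0,\ldots,y_{n-1},x_{n-1},x_0,y_0,\ldots,x_{n-1},y_{n-1})$$ also hold in $\mathcal V$. The clone algebra $\mathfrak A(\mathcal V)$ of a variety $\mathcal V$ (in the sense of W. Taylor) is the heterogeneous (many-sorted) algebra whose sort indexed by the positive integer $k$ is the set of equivalence classes of $k$-ary terms of $\mathcal V$, two $k$-ary terms $t_1,t_2$ being equivalent iff the identity $t_1\approx t_2$ holds in $\mathcal V$. Its operations are the substitution operations, which for all $k,m$ send a $k$-ary $t$ and $m$-ary $s_1,\ldots,s_k$ to the $m$-ary $t(s_1,\ldots,s_k)$, together with constants naming, for each $k$ and each $1\le i\le k$, the $i$-th $k$-ary projection (the class of the variable $x_i$ as a $k$-ary term). The language of clone algebras of varieties is the corresponding many-sorted first-order language (with equality; quantifiers range over individual sorts). In this language each $M(n)$ is expressed by a first-order sentence. *)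

(* Defs.v *)
From mathcomp Require Import all_boot.
From mathcomp Require Import boolp classical_sets.

Set Implicit Arguments.
Unset Strict Implicit.
Unset Printing Implicit Defensive.

Local Open Scope classical_set_scope.

Record signature : Type := Signature {
  symbol : Type;
  arity : symbol -> nat
}.

Record algebra (S : signature) : Type := Algebra {
  carrier :> Type;
  op : forall f : symbol S, ('I_(arity f) -> carrier) -> carrier;
  carrier_nonempty : inhabited carrier
}.

Inductive term (S : signature) (X : Type) : Type :=
  | Var (x : X)
  | App (f : symbol S) (args : 'I_(arity f) -> term S X).
Arguments Var {S X} x.
Arguments App {S X} f args.

Fixpoint eval (S : signature) (A : algebra S) (X : Type) (a : X -> A)
    (t : term S X) : A :=
  match t with
  | Var x => a x
  | App f args => op (fun i => eval a (args i))
  end.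

Fixpoint subst (S : signature) (X Y : Type) (s : X -> term S Y)
    (t : term S X) : term S Y :=
  match t with
  | Var x => s x
  | App f args => App f (fun i => subst s (args i))
  end.

(* A variety is an equational class, given by its signature and a set of
   defining identities in countably many variables. *)
Record variety : Type := Variety {
  vsig :> signature;
  axioms : set (term vsig nat * term vsig nat)
}.

Definition satisfies (S : signature) (A : algebra S) (X : Type)
    (s t : term S X) : Prop :=
  forall a : X -> A, eval a s = eval a t.

Definition in_variety (V : variety) (A : algebra V) : Prop :=
  forall s t : term V nat, axioms (s, t) -> satisfies A s t.

Definition holds (V : variety) (X : Type) (s t : term V X) : Prop :=
  forall A : algebra V, in_variety A -> satisfies A s t.

Definition compatible (S : signature) (A : algebra S) (r : set (A * A)) : Prop :=
  forall (f : symbol S) (a b : 'I_(arity f) -> A),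
    (forall i, r (a i, b i)) -> r (op a, op b).

Definition tolerance (S : signature) (A : algebra S) (r : set (A * A)) : Prop :=
  [/\ forall a, r (a, a),
      forall a b, r (a, b) -> r (b, a)
    & compatible r].

Definition congruence (S : signature) (A : algebra S) (r : set (A * A)) : Prop :=
  tolerance r /\ forall a b c, r (a, b) -> r (b, c) -> r (a, c).

Definition homomorphism (S : signature) (B A : algebra S) (phi : B -> A) : Prop :=
  forall (f : symbol S) (b : 'I_(arity f) -> B),
    phi (op b) = op (fun i => phi (b i)).

Definition TImC (V : variety) : Prop :=
  forall A : algebra V, in_variety A ->
  forall tau : set (A * A), tolerance tau ->
  exists (B : algebra V) (theta : set (B * B)) (phi : B -> A),
    [/\ in_variety B, congruence theta, homomorphism phi
      & tau = [set (phi p.1, phi p.2) | p in theta]].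

Lemma half_ord_proof (n : nat) (i : 'I_(2 * n)) : i./2 < n.
Proof. by rewrite ltn_half_double -mul2n. Qed.

Definition half_ord (n : nat) (i : 'I_(2 * n)) : 'I_n :=
  Ordinal (half_ord_proof i).

(* The sequence x_0, y_0, x_1, y_1, ..., x_(n-1), y_(n-1). *)
Definition interleave (T : Type) (n : nat) (x y : 'I_n -> T) (i : 'I_(2 * n)) : T :=
  if odd i then y (half_ord i) else x (half_ord i).

Definition concat (T : Type) (m n : nat) (u : 'I_m -> T) (v : 'I_n -> T)
    (i : 'I_(m + n)) : T :=
  match split i with inl j => u j | inr j => v j end.

(* k-ary terms are terms over 'I_k; the variables x_i and y_i of the last two
   identities are the elements inl i and inr i of 'I_n + 'I_n. *)
Definition M (n : nat) (V : variety) : Prop :=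
  forall f g : term V 'I_(2 * n),
    holds (subst (interleave Var Var) f) (subst (interleave Var Var) g) ->
  exists h : term V 'I_(2 * n + 2 * n),
    let x (i : 'I_n) : term V ('I_n + 'I_n) := Var (inl i) in
    let y (i : 'I_n) : term V ('I_n + 'I_n) := Var (inr i) in
    holds (subst (interleave x y) f)
          (subst (concat (interleave x y) (interleave x y)) h) /\
    holds (subst (interleave x y) g)
          (subst (concat (interleave y x) (interleave x y)) h).

(* Sorts are indexed by the positive integers; throughout, the index k : nat
   stands for the sort of (k+1)-ary operations. *)
Record clone_structure : Type := CloneStructure {
  sort :> nat -> Type;
  comp : forall k m : nat, sort k -> ('I_k.+1 -> sort m) -> sort m;
  proj : forall k : nat, 'I_k.+1 -> sort k
}.

(* Formulas are well scoped: a context is the list of the sorts of the free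
   variables, and a variable is a position in it (de Bruijn index). *)
Inductive cvar : seq nat -> nat -> Type :=
  | CVhere (G : seq nat) (k : nat) : cvar (k :: G) k
  | CVthere (G : seq nat) (k l : nat) : cvar G k -> cvar (l :: G) k.

Inductive cterm (G : seq nat) : nat -> Type :=
  | CVar (k : nat) : cvar G k -> cterm G k
  | CComp (k m : nat) : cterm G k -> ('I_k.+1 -> cterm G m) -> cterm G m
  | CProj (k : nat) : 'I_k.+1 -> cterm G k.

Inductive cformula : seq nat -> Type :=
  | CEq (G : seq nat) (k : nat) : cterm G k -> cterm G k -> cformula G
  | CFalse (G : seq nat) : cformula G
  | CAnd (G : seq nat) : cformula G -> cformula G -> cformula G
  | COr (G : seq nat) : cformula G -> cformula G -> cformula G
  | CImp (G : seq nat) : cformula G -> cformula G -> cformula G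
  | CForall (G : seq nat) (k : nat) : cformula (k :: G) -> cformula G
  | CExists (G : seq nat) (k : nat) : cformula (k :: G) -> cformula G.

Definition csentence : Type := cformula [::].

Fixpoint cenv (C : clone_structure) (G : seq nat) : Type :=
  if G is k :: G' then (C k * cenv C G')%type else unit.

Fixpoint cvar_eval (C : clone_structure) (G : seq nat) (k : nat)
    (v : cvar G k) : cenv C G -> C k :=
  match v in cvar G k return cenv C G -> C k with
  | CVhere _ _ => fun e => e.1
  | CVthere _ _ _ w => fun e => cvar_eval w e.2
  end.

Fixpoint cterm_eval (C : clone_structure) (G : seq nat) (e : cenv C G)
    (k : nat) (t : cterm G k) : C k :=
  match t in cterm _ k return C k with
  | CVar _ v => cvar_eval v e
  | CComp _ _ t s => comp (cterm_eval e t) (fun i => cterm_eval e (s i))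
  | CProj _ i => proj C i
  end.

Fixpoint cformula_sat (C : clone_structure) (G : seq nat) (phi : cformula G) :
    cenv C G -> Prop :=
  match phi in cformula G return cenv C G -> Prop with
  | CEq _ _ s t => fun e => cterm_eval e s = cterm_eval e t
  | CFalse _ => fun _ => False
  | CAnd _ p q => fun e => cformula_sat p e /\ cformula_sat q e
  | COr _ p q => fun e => cformula_sat p e \/ cformula_sat q e
  | CImp _ p q => fun e => cformula_sat p e -> cformula_sat q e
  | CForall G k p => fun e => forall x : C k, cformula_sat p ((x, e) : cenv C (k :: G))
  | CExists G k p => fun e => exists x : C k, cformula_sat p ((x, e) : cenv C (k :: G))
  end.

Definition models (C : clone_structure) (phi : csentence) : Prop :=
  cformula_sat (C := C) phi tt.

Definition term_class (V : variety) (k : nat) (t : term V 'I_k.+1) :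
    set (term V 'I_k.+1) :=
  [set s | holds t s].

Definition clone_sort (V : variety) (k : nat) : Type :=
  {c : set (term V 'I_k.+1) | exists t, c = term_class t}.

Definition clone_class (V : variety) (k : nat) (t : term V 'I_k.+1) :
    clone_sort V k :=
  exist _ (term_class t) (ex_intro _ t erefl).

Definition clone_repr (V : variety) (k : nat) (c : clone_sort V k) :
    term V 'I_k.+1 :=
  sval (cid (svalP c)).

(* Defined through representatives; independent of them by clone_compE. *)
Definition clone_comp (V : variety) (k m : nat) (c : clone_sort V k)
    (d : 'I_k.+1 -> clone_sort V m) : clone_sort V m :=
  clone_class (subst (fun i => clone_repr (d i)) (clone_repr c)).

Definition clone_algebra (V : variety) : clone_structure :=
  CloneStructure (@clone_comp V) (fun k (i : 'I_k.+1) => clone_class (Var i)).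

Lemma eval_subst (S : signature) (A : algebra S) (X Y : Type)
    (s : X -> term S Y) (a : Y -> A) (t : term S X) :
  eval a (subst s t) = eval (fun x => eval a (s x)) t.
Proof.
elim: t => [//|f args IH] /=; congr op.
by apply: functional_extensionality_dep => i; exact: IH.
Qed.

Lemma clone_classP (V : variety) (k : nat) (s t : term V 'I_k.+1) :
  clone_class s = clone_class t <-> holds s t.
Proof.
split=> [/(congr1 sval) /= st | st].
  have : term_class t t by [].
  by rewrite -st.
apply: eq_sig_hprop => /= [c|]; first exact: Prop_irrelevance.
apply/seteqP; split=> u hu A VA a.
  by rewrite -(st A VA a) (hu A VA a).
by rewrite (st A VA a) (hu A VA a).
Qed.

Lemma clone_reprK (V : variety) (k : nat) (c : clone_sort V k) :
  clone_class (clone_repr c) = c.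
Proof.
apply: eq_sig_hprop => /= [d|]; first exact: Prop_irrelevance.
by rewrite /clone_repr; case: cid => t /= <-.
Qed.

Lemma clone_compE (V : variety) (k m : nat) (t : term V 'I_k.+1)
    (s : 'I_k.+1 -> term V 'I_m.+1) :
  clone_comp (clone_class t) (fun i => clone_class (s i)) =
  clone_class (subst s t).
Proof.
apply/clone_classP => A VA a; rewrite !eval_subst.
have /clone_classP/(_ A VA) -> := clone_reprK (clone_class t).
congr eval; apply: functional_extensionality_dep => i.
by have /clone_classP/(_ A VA) -> := clone_reprK (clone_class (s i)).
Qed.

(* Main.v *)
Require Import Defs.
From Stdlib Require List.
From mathcomp Require Import all_boot.
From mathcomp Require Import boolp classical_sets.

Set Implicit Arguments.
Unset Strict Implicit.
Unset Printing Implicit Defensive.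

Local Open Scope classical_set_scope.

(** For (i), a pair of [2n]-ary terms is also a pair of [2(n+1)]-ary terms with
    two dummy variables; in the [4(n+1)]-ary term [h] obtained from [M(n+1)],
    the extra pair of variables in each block is then identified with another
    pair of the block ([M_retract]).

    Parts (ii) and (iii) rest on one family of varieties. Take a constant [0]
    and two [m]-ary operations, and let [injective_only m] be axiomatized by
    saying that both operations give [0] whenever two of their arguments
    coincide. With [k] variables and [k + 1 < m], an operation applied to
    variables and [0] has a repeated argument by the pigeonhole principle;
    hence every [k]-ary term is a variable or [0] ([small_term]). For such
    terms, [M(n)] holds by inspection as soon as [2n + 1 < m].

    On the other hand the two operations agree when their arguments are not
    distinct, but nothing ties their values on distinct arguments: in
    [marked_algebra] these values are two distinct marks, and an operation
    always takes its own mark or [0]. So a term whose variables are generators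
    can produce at most one of the two marks, whatever the generators are
    ([mark_unique]), which refutes [M(n)] for [m = 2n]. In the same way, the
    relation of not being two different marks is a tolerance. If it were the
    image of a congruence, then lifting two related generators would make the
    two marks congruent to [0] upstairs, hence congruent to each other
    ([injective_only_not_TImC]).

    The subvariety [constant_ops m], in which both operations are constantly
    [0], is the variety of pointed sets up to term equivalence. It satisfies
    TImC: the edges of a tolerance, each doubled into its two ends, form an
    algebra, and being ends of the same edge is a congruence of it
    ([constant_ops_TImC]). The canonical map from the clone of [injective_only
    m] onto that of [constant_ops m] is a surjective homomorphism, and by
    [small_term] it is injective on the sorts whose arity is small compared
    to [m]. Such a map preserves and reflects every formula whose equations
    live in those sorts ([sat_transfer]). So for [m] large, a given finite
    [Sigma] does not distinguish the two varieties, whereas TImC does. *)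

(** * Evaluating the condition M(n) in algebras *)

Lemma interleave_comp (T U : Type) (n : nat) (phi : T -> U) (x y : 'I_n -> T) :
  (fun i => phi (interleave x y i)) = interleave (phi \o x) (phi \o y).
Proof. by apply: funext => i; rewrite /interleave; case: ifP. Qed.

Lemma concat_comp (T U : Type) (m n : nat) (phi : T -> U)
    (u : 'I_m -> T) (v : 'I_n -> T) :
  (fun i => phi (concat u v i)) = concat (phi \o u) (phi \o v).
Proof. by apply: funext => i; rewrite /concat; case: split. Qed.

(** Valuations of the variables [x_i] and [y_i] in an algebra replace the
    substitutions of variables, so that proofs reason about elements. *)
Lemma M_eval (n : nat) (V : variety) :
  M n V <->
  forall f g : term V 'I_(2 * n),
    (forall A : algebra V, in_variety A -> forall x : 'I_n -> A,
       eval (interleave x x) f = eval (interleave x x) g) ->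
  exists h : term V 'I_(2 * n + 2 * n),
    forall A : algebra V, in_variety A -> forall x y : 'I_n -> A,
      eval (interleave x y) f =
        eval (concat (interleave x y) (interleave x y)) h /\
      eval (interleave x y) g =
        eval (concat (interleave y x) (interleave x y)) h.
Proof.
split=> MV f g fg.
  have [|h [hf hg]] := MV f g.
    move=> A VA a; rewrite !eval_subst !interleave_comp.
    exact: (fg A VA a).
  exists h => A VA x y.
  pose a (s : 'I_n + 'I_n) := match s with inl i => x i | inr i => y i end.
  move: (hf A VA a) (hg A VA a); rewrite !eval_subst.
  by rewrite !concat_comp /comp !interleave_comp.
have [|h hfg] := MV f g.
  move=> A VA x; have := fg A VA x.
  by rewrite !eval_subst !interleave_comp.
exists h; split=> A VA a; rewrite !eval_subst !concat_comp /comp !interleave_comp.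
  by have [] := hfg A VA (a \o inl) (a \o inr).
by have [] := hfg A VA (a \o inl) (a \o inr).
Qed.

(** * Monotonicity of M(n) *)

Lemma pair_map_proof (k l : nat) (p : 'I_k -> 'I_l) (i : 'I_(2 * k)) :
  odd i + (p (half_ord i)).*2 < 2 * l.
Proof. by rewrite [2 * l]mul2n -ltn_half_double half_bit_double. Qed.

(** The map of indices induced by [p] when index [i] carries the two positions
    [2i] and [2i+1] of [x_i] and [y_i]. *)
Definition pair_map (k l : nat) (p : 'I_k -> 'I_l) (i : 'I_(2 * k)) : 'I_(2 * l) :=
  Ordinal (pair_map_proof p i).

Lemma interleave_pair_map (T : Type) (k l : nat) (p : 'I_k -> 'I_l)
    (x y : 'I_l -> T) :
  (fun i => interleave x y (pair_map p i)) = interleave (x \o p) (y \o p).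
Proof.
apply: funext => i; rewrite /interleave /= oddD odd_double addbF oddb.
suff -> : half_ord (pair_map p i) = p (half_ord i) by [].
by apply: val_inj; rewrite /= half_bit_double.
Qed.

(** Lift the two terms along [w], apply the condition, and come back along [p];
    since [p] inverts [w], evaluating the lifted terms at [x \o p] and [y \o p]
    gives the values of the original ones at [x] and [y]. *)
Lemma M_retract (V : variety) (k l : nat) (w : 'I_l -> 'I_k) (p : 'I_k -> 'I_l) :
  cancel w p -> M k V -> M l V.
Proof.
move=> wK /M_eval MV; apply/M_eval => f g fg.
pose lift t := subst (fun i => Var (pair_map w i)) t : term V 'I_(2 * k).
have eval_lift (A : algebra V) (x y : 'I_k -> A) t :
    eval (interleave x y) (lift t) = eval (interleave (x \o w) (y \o w)) t.
  by rewrite eval_subst -(interleave_pair_map w x y).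
have [|h hfg] := MV (lift f) (lift g).
  by move=> A VA x; rewrite !eval_lift; exact: fg.
exists (subst (concat (fun i => Var (lshift _ (pair_map p i)))
                      (fun i => Var (rshift _ (pair_map p i)))) h).
move=> A VA x y.
have eval_retract (u v u' v' : 'I_l -> A) :
    eval (concat (interleave u v) (interleave u' v'))
      (subst (concat (fun i => Var (lshift _ (pair_map p i)))
                     (fun i => Var (rshift _ (pair_map p i)))) h) =
    eval (concat (interleave (u \o p) (v \o p)) (interleave (u' \o p) (v' \o p))) h.
  rewrite eval_subst concat_comp -(interleave_pair_map p u v)
    -(interleave_pair_map p u' v'); congr eval.
  congr concat; apply: funext => i /=; rewrite /concat.
    by rewrite (unsplitK (inl _)).
  by rewrite (unsplitK (inr _)).
have pw (u : 'I_l -> A) : (u \o p) \o w = u.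
  by apply: funext => i /=; rewrite wK.
have [] := hfg A VA (x \o p) (y \o p).
by rewrite !eval_lift !pw !eval_retract.
Qed.

(** * Two operations that vanish on repeated arguments *)

Definition two_ops (m : nat) : signature :=
  @Signature (option bool) (fun s => if s is Some _ then m else 0).

Definition no_args (T : Type) (i : 'I_0) : T :=
  match notF (ltn_ord i) with end.

Lemma no_argsE (T : Type) (a : 'I_0 -> T) : a = @no_args T.
Proof. by apply: funext => -[]. Qed.

Definition zero_term (m : nat) (X : Type) : term (two_ops m) X :=
  @App (two_ops m) X None (@no_args _).

Definition zero (m : nat) (A : algebra (two_ops m)) : A :=
  @op _ A None (@no_args _).

Lemma eval_zero (m : nat) (A : algebra (two_ops m)) (X : Type) (a : X -> A) :
  eval a (zero_term m X) = zero A.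
Proof. by rewrite /= [X in op X]no_argsE. Qed.

(** The axioms make the operations vanish on the argument patterns in [Q]; a
    pattern lists which variable stands at each place. *)
Definition collapsing (m : nat) (Q : set ('I_m -> nat)) : variety :=
  @Variety (two_ops m)
    [set st | exists b u, Q u /\
       st = (@App (two_ops m) nat (Some b) (fun i => Var (u i)), zero_term m nat)].

Lemma in_collapsing (m : nat) (Q : set ('I_m -> nat)) (A : algebra (two_ops m)) :
  @in_variety (collapsing Q) A <->
  forall b u (v : nat -> A), Q u ->
    @op _ A (Some b) (fun i => v (u i)) = zero A.
Proof.
split=> [VA b u v Qu | VA s t [b [u [Qu [-> ->]]]] v].
  have ax : axioms (v := collapsing Q)
      (@App (two_ops m) nat (Some b) (fun i => Var (u i)), zero_term m nat).
    by exists b, u.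
  by rewrite -(eval_zero v) -(VA _ _ ax v).
by rewrite eval_zero; exact: VA.
Qed.

Definition injective_only (m : nat) : variety :=
  collapsing [set u : 'I_m -> nat | ~ injective u].

Definition constant_ops (m : nat) : variety :=
  collapsing [set: 'I_m -> nat].

Lemma in_injective_only (m : nat) (A : algebra (two_ops m)) :
  @in_variety (injective_only m) A <->
  forall b (a : 'I_m -> A), ~ injective a -> @op _ A (Some b) a = zero A.
Proof.
split=> [/in_collapsing VA b a /existsNP[i /existsNP[j ]] | VA].
  move=> /not_implyP[aij nij].
  (* a pattern that repeats exactly at the coincidence of a i and a j *)
  pose u (k : 'I_m) : nat := if k == j then i else k.
  pose v (n : nat) : A := if insub n is Some k then a k else zero A.
  have -> : a = fun k => v (u k).
    by apply: funext => k; rewrite /v /u; case: eqP => [->|_]; rewrite valK.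
  apply: VA => inj_u; apply: nij; apply: inj_u.
  by rewrite /u eqxx; case: eqP.
apply/in_collapsing => b u v nu; apply: VA => inj_vu; apply: nu => i j uij.
by apply: inj_vu; rewrite uij.
Qed.

Lemma in_constant_ops (m : nat) (A : algebra (two_ops m)) :
  @in_variety (constant_ops m) A <->
  forall b (a : 'I_m -> A), @op _ A (Some b) a = zero A.
Proof.
split=> [/in_collapsing VA b a | VA]; last by apply/in_collapsing => *; exact: VA.
pose v (n : nat) : A := if insub n is Some k then a k else zero A.
have -> : a = fun k : 'I_m => v k by apply: funext => k; rewrite /v valK.
exact: VA.
Qed.

Lemma constant_ops_sub (m : nat) (A : algebra (two_ops m)) :
  @in_variety (constant_ops m) A -> @in_variety (injective_only m) A.
Proof. by move=> /in_constant_ops WA; apply/in_injective_only => *; exact: WA. Qed.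

(** A shape shared by the two models needed below: [None] is the zero, and the
    two operations may take only one further value each, given by [h]. *)
Definition test_algebra (m : nat) (X : eqType) (h : bool -> option X) :
    algebra (two_ops m) :=
  @Algebra (two_ops m) (option X)
    (fun s => match s return ('I_(@arity (two_ops m) s) -> option X) -> option X with
              | Some b => fun a => if injectiveb a then h b else None
              | None => fun _ => None
              end)
    (inhabits None).

Lemma test_algebra_injective_only (m : nat) (X : eqType) (h : bool -> option X) :
  @in_variety (injective_only m) (test_algebra m h).
Proof. by apply/in_injective_only => b a /= /injectiveP/negbTE ->. Qed.

(** A model of the smaller variety that still separates distinct variables from
    each other and from the zero. *)
Definition flat_algebra (m : nat) := test_algebra m (fun=> @None nat).

Lemma flat_algebra_constant_ops (m : nat) :
  @in_variety (constant_ops m) (flat_algebra m).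
Proof. by apply/in_constant_ops => b a /=; case: ifP. Qed.

(** * Small arities *)

Definition flat_term (m : nat) (X : Type) (o : option X) : term (two_ops m) X :=
  if o is Some i then Var i else zero_term m X.

Lemma eval_flat_term (m : nat) (X : Type) (a : X -> nat) (o : option X) :
  eval (Some \o a : X -> flat_algebra m) (flat_term m o) = omap a o.
Proof. by case: o. Qed.

(** By induction the arguments of an operation reduce to variables or zero, that
    is, to [k + 1] possibilities for [m > k + 1] places, so two of them coincide. *)
Lemma small_term (m k : nat) (t : term (two_ops m) 'I_k) :
  k.+1 < m -> exists o, @holds (injective_only m) _ t (flat_term m o).
Proof.
move=> km; elim: t => [i|[b|] args IH]; first by exists (Some i).
  have [o ho] := choice IH; exists None => A VA a.
  rewrite eval_zero; move/in_injective_only: (VA); apply => inj.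
  have : injective (o : 'I_m -> option 'I_k).
    move=> i j oij; apply: inj; have := ho i A VA a; rewrite oij => oi.
    exact: etrans oi (esym (ho j A VA a)).
  by move/leq_card; rewrite card_option !card_ord leqNgt km.
by exists None => A VA a; rewrite eval_zero /= [X in op X]no_argsE.
Qed.

(** Both terms reduce to a variable or to zero, and the hypothesis says that they
    become equal when [x_i] and [y_i] are identified. So they are equal, or they
    are [x_i] and [y_i] for the same [i]. *)
Lemma injective_only_M (m n : nat) : (2 * n).+1 < m -> M n (injective_only m).
Proof.
move=> nm; apply/M_eval => f g fg.
have [o fo] := small_term f nm; have [o' go'] := small_term g nm.
have FV := @constant_ops_sub m _ (@flat_algebra_constant_ops m).
have oo' : omap (@half_ord n) o = omap (@half_ord n) o'.
  pose x (i : 'I_n) : flat_algebra m := Some (i : nat).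
  have xxE : interleave x x = Some \o (@nat_of_ord n \o @half_ord n).
    by apply: funext => i; rewrite /interleave; case: ifP.
  have := fg _ FV x; rewrite (fo _ FV) (go' _ FV) xxE !eval_flat_term.
  by case: o o' {fo go'} => [i|] [j|] //= [] ij; congr Some; exact: val_inj.
(* The second block of variables of h is the same in both identities, and the
   first one exchanges x and y: use the second if f and g agree, the first if
   they are the two members of a pair. *)
pose slot (i : 'I_(2 * n)) :=
  if o == o' then rshift (2 * n) i else lshift (2 * n) i.
exists (flat_term m (omap slot o)).
move=> A VA x y; rewrite (fo _ VA) (go' _ VA).
rewrite {}/slot; case: o o' oo' {fo go'} => [i|] [j|] //= => [[]|_]; last first.
  by split; exact: etrans (eval_zero _) (esym (eval_zero _)).
move=> ij; have [[<-]|nij] := eqVneq (Some i) (Some j).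
  by rewrite /concat (unsplitK (inr _)).
have hij : half_ord i = half_ord j by exact: val_inj.
rewrite /concat (unsplitK (inl _)) /interleave -hij.
have : odd i != odd j.
  apply: contra_neq nij => oij; congr Some; apply: val_inj.
  by rewrite /= -[LHS]odd_double_half -[RHS]odd_double_half oij ij.
by case: (odd i); case: (odd j).
Qed.

(** * Failure of M(n) and of TImC *)

Definition marked_algebra (m : nat) :=
  test_algebra m (fun b => Some (inr b : nat + bool)).

Definition generator (m : nat) (i : nat) : marked_algebra m := Some (inl i).

Definition mark (m : nat) (b : bool) : marked_algebra m := Some (inr b).

Definition op_term (m : nat) (b : bool) : term (two_ops m) 'I_m :=
  @App (two_ops m) 'I_m (Some b) Var.

Lemma op_generators (m : nat) (b : bool) :
  eval (fun i : 'I_m => generator m i) (op_term m b) = mark m b.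
Proof. by rewrite /= ifT //; apply/injectiveP => i j [/val_inj]. Qed.

(** The generators are not marks, so the term is an operation applied to
    something, and the value can only be the mark of that operation or zero. *)
Lemma mark_unique (m : nat) (X : Type) (t : term (two_ops m) X) (u v : X -> nat)
    (b c : bool) :
  eval (generator m \o u) t = mark m b -> eval (generator m \o v) t = mark m c ->
  b = c.
Proof.
case: t => [//|[d|] args] //=.
by case: ifP => // _ [<-]; case: ifP => // _ [<-].
Qed.

Lemma interleave_diag_not_injective (T : Type) (n : nat) (x : 'I_n -> T) :
  0 < n -> ~ injective (interleave x x).
Proof.
move=> n_gt0 inj_xx.
have : injective (@half_ord n).
  by move=> i j ij; apply: inj_xx; rewrite /interleave ij !if_same.
by move/leq_card; rewrite !card_ord leqNgt mul2n -addnn -{1}[n]addn0 ltn_add2l n_gt0.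
Qed.

Lemma injective_only_not_M (n : nat) : 0 < n -> ~ M n (injective_only (2 * n)).
Proof.
move=> n_gt0 /M_eval /(_ (op_term _ true) (op_term _ false))[|h hfg].
  move=> A /in_injective_only opA x.
  by rewrite /= !opA //; exact: interleave_diag_not_injective.
pose x (i : 'I_n) := i.*2; pose y (i : 'I_n) := i.*2.+1.
have xy : interleave x y = @nat_of_ord (2 * n).
  apply: funext => i; rewrite /interleave /x /y /= -[in RHS](odd_double_half i).
  by case: (odd i).
have [] := hfg _ (@test_algebra_injective_only _ _ _)
  (generator (2 * n) \o x) (generator (2 * n) \o y).
rewrite -!interleave_comp -!concat_comp xy !op_generators => fh gh.
by have := mark_unique (esym fh) (esym gh).
Qed.

(** Upstairs, both operations at preimages of distinct generators are congruent
    to the zero, because replacing one argument by a congruent one creates a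
    repetition. Hence the two marks would be related downstairs. *)
Lemma injective_only_not_TImC (m : nat) : 1 < m -> ~ TImC (injective_only m).
Proof.
move=> m_gt1 T.
pose tau : set (marked_algebra m * marked_algebra m) :=
  [set p : marked_algebra m * marked_algebra m |
    forall b c, p.1 = mark m b -> p.2 = mark m c -> b = c].
have tau_tol : tolerance tau.
  split=> [a b c /= -> [] //|a b ab c d /= ac bd|[b|] a a' aa' c d //=].
    by rewrite (ab d c).
  by case: ifP => // _ [<-]; case: ifP => // _ [<-].
have [B [theta [phi [VB [[th_refl th_sym th_op] th_trans] phi_hom tauE]]]] :=
  T _ (@test_algebra_injective_only _ _ _) tau tau_tol.
pose e i := if i == 1 then 0 else i.
have lift i : exists p : B * B,
    [/\ theta p, phi p.1 = generator m i & phi p.2 = generator m (e i)].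
  have : tau (generator m i, generator m (e i)) by [].
  by rewrite tauE => -[p thp [p1 p2]]; exists p.
have [p p_lift] := choice lift.
(* The family a lists preimages of the generators, and a' differs from it only
   in repeating a 0 at place 1. The lift of the pair (1, 0) supplies both a 1 and
   a 0, which makes them theta-related. *)
pose a i := if i == 0 then (p 1).2 else (p i).1.
pose a' i := a (e i).
have th_a i : theta (a i, a' i).
  rewrite /a' /e /a; case: (eqVneq i 1) => [->|_] /=; last exact: th_refl.
  by have [+ _ _] := p_lift 1; case: (p 1).
have phi_a i : phi (a i) = generator m i.
  rewrite /a; case: eqP => [->|_]; first by have [] := p_lift 1.
  by have [] := p_lift i.
pose s b := @op _ B (Some b) (fun i : 'I_m => a i).
have th_zero b : theta (s b, zero B).
  have <- : @op _ B (Some b) (fun i : 'I_m => a' i) = zero B.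
    move/in_injective_only: VB; apply.
    by move=> /(_ (Ordinal (ltnW m_gt1)) (Ordinal m_gt1) erefl).
  by apply: th_op => i; exact: th_a.
have phi_s b : phi (s b) = mark m b.
  rewrite phi_hom -op_generators /=; congr (if injectiveb _ then _ else _).
  by apply: funext => i; exact: phi_a.
have : tau (mark m true, mark m false).
  rewrite tauE; exists (s true, s false); last by rewrite /= !phi_s.
  by apply: th_trans (th_zero true) _; apply: th_sym; exact: th_zero.
by move=> /(_ true false erefl erefl).
Qed.

(** * Pointed sets satisfy TImC *)

(** The covering algebra consists of the edges of the tolerance with a choice of
    one end. As the operations are constant, any equivalence relation on it is
    a congruence; a loop at the zero serves as its zero, so that the projection
    to the chosen end is a homomorphism. *)
Lemma constant_ops_TImC (m : nat) : TImC (constant_ops m).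
Proof.
move=> A /in_constant_ops WA tau [tau_refl tau_sym _].
pose edge := {p : A * A | tau p}.
pose o : edge := exist _ (zero A, zero A) (tau_refl (zero A)).
pose B := @Algebra (two_ops m) (edge * bool) (fun _ _ => (o, false))
  (inhabits (o, false)).
pose theta : set (B * B) := [set uv | uv.1.1 = uv.2.1].
pose phi (u : B) : A := if u.2 then (sval u.1).2 else (sval u.1).1.
exists B, theta, phi; split.
- by apply/in_constant_ops.
- split; first by split=> // a b; exact: esym.
  by move=> a b c; exact: etrans.
- move=> [b|] u; first by rewrite [RHS]WA.
  by rewrite [X in _ = op X]no_argsE.
apply/seteqP; split=> [[a b] tab|_ [[[u b] [v c]] /= uv <-]].
  pose u : edge := exist _ (a, b) tab.
  by exists ((u, false), (u, true)).
have <- : u = v := uv; rewrite /phi /=; case: u {uv} => -[a1 a2] /= ta.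
by case: b; case: c => //; exact: tau_sym.
Qed.

(** * Transfer of formulas between clones *)

(** Only the sorts of equations count: a surjective homomorphism respects
    quantifiers and the value of terms in every sort. *)
Fixpoint eq_rank (G : seq nat) (phi : cformula G) : nat :=
  match phi with
  | CEq _ k _ _ => k
  | CFalse _ => 0
  | CAnd _ p q | COr _ p q | CImp _ p q => maxn (eq_rank p) (eq_rank q)
  | CForall _ _ p | CExists _ _ p => eq_rank p
  end.

Section Transfer.
Variables (C D : clone_structure) (F : forall k, C k -> D k).
Hypothesis F_comp : forall k m (c : C k) (d : 'I_k.+1 -> C m),
  F (Defs.comp c d) = Defs.comp (F c) (fun i => F (d i)).
Hypothesis F_proj : forall k (i : 'I_k.+1), F (proj C i) = proj D i.
Hypothesis F_surj : forall k (d : D k), exists c, F c = d.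

Fixpoint map_env (G : seq nat) : cenv C G -> cenv D G :=
  match G with
  | [::] => fun _ => tt
  | k :: G' => fun e => (F e.1, map_env e.2)
  end.

Lemma map_env_var (G : seq nat) k (v : cvar G k) (e : cenv C G) :
  cvar_eval v (map_env e) = F (cvar_eval v e).
Proof. by elim: v e => [G' k' e //|G' k' l w IH e] /=; exact: IH. Qed.

Lemma map_env_term (G : seq nat) (e : cenv C G) k (t : cterm G k) :
  cterm_eval (map_env e) t = F (cterm_eval e t).
Proof.
elim: t => [k' v|k' m' t IHt s IHs|k' i] /=; first exact: map_env_var.
  by rewrite IHt F_comp; congr Defs.comp; apply: funext.
by rewrite F_proj.
Qed.

(** Surjectivity lets quantifiers range over the images, and injectivity is used
    to reflect the equations of the formula. *)
Lemma sat_transfer (N : nat) (G : seq nat) (phi : cformula G) (e : cenv C G) :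
  (forall k (c c' : C k), k <= N -> F c = F c' -> c = c') ->
  eq_rank phi <= N -> (cformula_sat phi e <-> cformula_sat phi (map_env e)).
Proof.
move=> F_inj; elim: phi e => {G}
  [G k s t|G|G p IHp q IHq|G p IHp q IHq|G p IHp q IHq|G k p IHp|G k p IHp] e //=.
- by move=> kN; rewrite !map_env_term; split=> [->//|]; exact: F_inj.
- by rewrite geq_max => /andP[/IHp - /(_ e) ? /IHq - /(_ e) ?]; tauto.
- by rewrite geq_max => /andP[/IHp - /(_ e) ? /IHq - /(_ e) ?]; tauto.
- by rewrite geq_max => /andP[/IHp - /(_ e) ? /IHq - /(_ e) ?]; tauto.
- move=> /IHp{}IHp; split=> [pe d|pe c].
    by have [c <-] := F_surj d; exact/(IHp (c, e)).
  by apply/(IHp (c, e)); exact: pe.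
- move=> /IHp{}IHp; split=> [[c pc]|[d]].
    by exists (F c); exact/(IHp (c, e)).
  by have [c <-] := F_surj d => pc; exists c; exact/(IHp (c, e)).
Qed.

End Transfer.

(** The canonical map given by the inclusion of the second variety in the first;
    by that inclusion, the choice of the representative does not matter. *)
Definition clone_map (m k : nat) (c : clone_algebra (injective_only m) k) :
    clone_algebra (constant_ops m) k :=
  @clone_class (constant_ops m) k (clone_repr c).

Lemma clone_map_class (m k : nat) (t : term (two_ops m) 'I_k.+1) :
  clone_map (@clone_class (injective_only m) k t) =
  @clone_class (constant_ops m) k t.
Proof.
apply/clone_classP => A /constant_ops_sub VA.
exact: (proj1 (clone_classP _ _) (clone_reprK (@clone_class (injective_only m) k t)) A VA).
Qed.

Lemma clone_map_comp (m k l : nat) (c : clone_algebra (injective_only m) k)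
    (d : 'I_k.+1 -> clone_algebra (injective_only m) l) :
  clone_map (Defs.comp c d) = Defs.comp (clone_map c) (fun i => clone_map (d i)).
Proof. by rewrite /= clone_map_class clone_compE. Qed.

Lemma clone_map_surj (m k : nat) (d : clone_algebra (constant_ops m) k) :
  exists c, clone_map c = d.
Proof.
exists (@clone_class (injective_only m) k (clone_repr d)).
by rewrite clone_map_class clone_reprK.
Qed.

(** Small terms reduce to variables or zero, and these are already separated by
    the flat algebra, which lies in the smaller variety. *)
Lemma clone_map_inj (m k : nat) (c c' : clone_algebra (injective_only m) k) :
  k.+2 < m -> clone_map c = clone_map c' -> c = c'.
Proof.
move=> km; rewrite -[c]clone_reprK -[c']clone_reprK !clone_map_class.
set s := clone_repr c; set t := clone_repr c'.
move=> /clone_classP st; apply/clone_classP.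
have [o so] := small_term s km; have [o' to'] := small_term t km.
suff oo' : o = o' by move=> A VA a; rewrite (so A VA a) (to' A VA a) oo'.
have FW := @flat_algebra_constant_ops m; have FV := @constant_ops_sub m _ FW.
have := st _ FW (Some \o @nat_of_ord k.+1).
rewrite (so _ FV) (to' _ FV) !eval_flat_term.
by case: o o' {so to'} => [i|] [j|] //= [] /val_inj ->.
Qed.

Lemma models_transfer (m : nat) (phi : csentence) :
  (eq_rank phi).+2 < m ->
  models (clone_algebra (injective_only m)) phi <->
  models (clone_algebra (constant_ops m)) phi.
Proof.
move=> hm; apply: (sat_transfer (@clone_map_comp m) _ (@clone_map_surj m) _ _ (leqnn _)).
  by move=> k i; exact: clone_map_class.
by move=> k c c' hk; apply: clone_map_inj; exact: leq_ltn_trans hm.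
Qed.

(** * The theorem *)

Theorem theorem2p2 :
  (forall n : nat, 0 < n -> forall V : variety, M n.+1 V -> M n V) /\
  (forall n : nat, 0 < n -> exists V : variety, M n V /\ ~ M n.+1 V) /\
  (forall Sigma : seq csentence,
     ~ (forall V : variety,
          (forall phi : csentence, List.In phi Sigma ->
             models (clone_algebra V) phi) <-> TImC V)).
Proof.
split; [|split].
- move=> [//|n] _ V.
  apply: (@M_retract V _ _ (widen_ord (leqnSn n.+1)) (fun i => inord i)) => i.
  by rewrite /= inord_val.
- move=> n _; exists (injective_only (2 * n.+1)); split.
    by apply: injective_only_M; rewrite mulnS.
  exact: injective_only_not_M.
- move=> Sigma TImCE.
  have [N hN] : exists N, forall phi, List.In phi Sigma -> eq_rank phi <= N.
    elim: Sigma {TImCE} => [|psi Sigma [N hN]]; first by exists 0.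
    exists (maxn (eq_rank psi) N) => phi /= [<-|/hN]; rewrite leq_max ?leqnn //.
    by move=> ->; rewrite orbT.
  apply: (@injective_only_not_TImC N.+3) => //.
  apply/TImCE => phi inS; apply/models_transfer; first by rewrite !ltnS hN.
  by move: phi inS; apply/TImCE; exact: constant_ops_TImC.
Qed.
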